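(* Let $G$ be a finite group and let $\mathcal V_G$, $\overline{\mathcal V}^\times_G$ and $\mathcal V^\times_G$ be the operads of $G$-categories built from injections ${}^jU\to U$, injections $U^j\to U$ and based injections $U^j\to U$, respectively. Then for each $j$ the classifying spaces $|\mathcal V_G(j)|$, $|\overline{\mathcal V}^\times_G(j)|$ and $|\mathcal V^\times_G(j)|$ are universal principal $(G,\Sigma_j)$-bundles; hence $\mathcal V_G$, $\overline{\mathcal V}^\times_G$ and $\mathcal V^\times_G$ are $E_\infty$ operads.
   Context: $|-|$ denotes the classifying space (realization of the nerve). A chaotic category is one with exactly one morphism between any two objects. A $(G\times\Sigma_j)$-space $E$ is (the total space of) a universal principal $(G,\Sigma_j)$-bundle if, for each subgroup $\Lambda\subset G\times\Sigma_j$, $E^\Lambda$ is contractible if $\Lambda\cap\Sigma_j=\{e\}$ and empty otherwise. An operad $\mathcal O_G$ of $G$-categories is an $E_\infty$ operad if $|\mathcal O_G|$ is an $E_\infty$ operad of $G$-spaces, meaning that $|\mathcal O_G(0)|$ is $G$-contractible and $|\mathcal O_G(j)|$ is a universal principal $(G,\Sigma_j)$-bundle for $j\ge1$. Let $U$ be a countable $G$-set that contains countably many copies of each orbit $G/H$. $U^j$ is the product of $j$ copies of $U$ with diagonal $G$-action ($U^0$ is a point), and ${}^jU$ is the disjoint union of $j$ copies of $U$ (${}^0U=\emptyset$). $\mathcal V_G(j)$ is the chaotic $G$-category whose objects are the injective functions ${}^jU\to U$, with $G$ acting by conjugation and $\Sigma_j$ acting from the right via its permutation action on ${}^jU$; the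 unit is $\mathrm{id}_U$, and $\gamma(\varphi;\varphi_1,\dots,\varphi_k)=\varphi\circ(\varphi_1\amalg\cdots\amalg\varphi_k)$. $\overline{\mathcal V}_G^\times(j)$ is the chaotic $G$-category whose objects are the injective functions $U^j\to U$, with $G$ acting by conjugation and $\Sigma_j$ acting from the right via its permutation action on $U^j$; the unit is $\mathrm{id}_U$, and $\gamma(\varphi;\varphi_1,\dots,\varphi_k)=\varphi\circ(\varphi_1\times\cdots\times\varphi_k)$. $\mathcal V_G^\times$ is the suboperad of $\overline{\mathcal V}_G^\times$ obtained by choosing a $G$-fixed point $1\in U$, giving $U^j$ the basepoint $(1,\dots,1)$ and restricting objects to the basepoint preserving injections $U^j\to U$. *)

(* Defs.v *)
From HB Require Import structures.
From mathcomp Require Import all_boot all_order all_algebra all_fingroup.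
From mathcomp Require Import generic_quotient.
From mathcomp Require Import all_classical all_reals all_analysis.
From Stdlib Require Import Relation_Operators.
Set Implicit Arguments.
Unset Strict Implicit.
Unset Printing Implicit Defensive.
Import Order.TTheory GRing.Theory Num.Theory.
Import numFieldNormedType.Exports.

Local Open Scope classical_set_scope.
Local Open Scope quotient_scope.
#[local] Obligation Tactic := try by [].

Record category := Category {
  obj :> Type;
  hom : obj -> obj -> Type;
  idm : forall a, hom a a;
  cmp : forall a b c, hom a b -> hom b c -> hom a c;
  cmp_idl : forall a b (f : hom a b), cmp (idm a) f = f;
  cmp_idr : forall a b (f : hom a b), cmp f (idm b) = f;
  cmp_assoc : forall a b c d (f : hom a b) (g : hom b c) (h : hom c d),
    cmp f (cmp g h) = cmp (cmp f g) h }.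

Record functor (C D : category) := Functor {
  fob :> C -> D;
  fmap : forall a b, hom a b -> hom (fob a) (fob b);
  fmap_id : forall a, fmap (idm a) = idm (fob a);
  fmap_cmp : forall a b c (f : hom a b) (g : hom b c),
    fmap (cmp f g) = cmp (fmap f) (fmap g) }.

Program Definition functor_id (C : category) : functor C C :=
  @Functor C C id (fun _ _ f => f) _ _.

Program Definition functor_comp (C D E : category)
    (F : functor D E) (H : functor C D) : functor C E :=
  @Functor C E (fun a => F (H a)) (fun _ _ f => fmap F (fmap H f)) _ _.
Next Obligation. by move=> C D E F H a; rewrite /= !fmap_id. Qed.
Next Obligation. by move=> C D E F H a b c f g; rewrite /= !fmap_cmp. Qed.

Program Definition functor_const (C D : category) (d : D) : functor C D :=
  @Functor C D (fun _ => d) (fun _ _ _ => idm d) _ _.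
Next Obligation. by move=> C D d a b c f g /=; rewrite /= cmp_idl. Qed.

Program Definition prod_category (C D : category) : category :=
  @Category (C * D)%type (fun a b => hom a.1 b.1 * hom a.2 b.2)%type
    (fun a => (idm a.1, idm a.2))
    (fun _ _ _ f g => (cmp f.1 g.1, cmp f.2 g.2)) _ _ _.
Next Obligation. by move=> C D a b [f g]; rewrite /= !cmp_idl. Qed.
Next Obligation. by move=> C D a b [f g]; rewrite /= !cmp_idr. Qed.
Next Obligation. by move=> C D a b c d f g h /=; rewrite !cmp_assoc. Qed.

Program Definition pi_category (I : Type) (C : I -> category) : category :=
  @Category (forall i, C i) (fun a b => forall i, hom (a i) (b i))
    (fun a i => idm (a i)) (fun _ _ _ f g i => cmp (f i) (g i)) _ _ _.
Next Obligation.
by move=> I C a b f; apply: functional_extensionality_dep => i; rewrite /= cmp_idl.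
Qed.
Next Obligation.
by move=> I C a b f; apply: functional_extensionality_dep => i; rewrite /= cmp_idr.
Qed.
Next Obligation.
move=> I C a b c d f g h; apply: functional_extensionality_dep => i.
by rewrite /= cmp_assoc.
Qed.

Program Definition functor_pair (X C D : category)
    (F : functor X C) (H : functor X D) : functor X (prod_category C D) :=
  @Functor X (prod_category C D) (fun x => (F x, H x))
    (fun _ _ f => (fmap F f, fmap H f)) _ _.
Next Obligation. by move=> X C D F H a; rewrite /= !fmap_id. Qed.
Next Obligation. by move=> X C D F H a b c f g; rewrite /= !fmap_cmp. Qed.

Program Definition functor_tuple (X : category) (I : Type) (C : I -> category)
    (F : forall i, functor X (C i)) : functor X (pi_category C) :=
  @Functor X (pi_category C) (fun x i => F i x) (fun _ _ f i => fmap (F i) f)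
    _ _.
Next Obligation.
move=> X I C F a; apply: functional_extensionality_dep => i.
by rewrite /= fmap_id.
Qed.
Next Obligation.
move=> X I C F a b c f g; apply: functional_extensionality_dep => i.
by rewrite /= fmap_cmp.
Qed.

Program Definition chaotic (T : Type) : category :=
  @Category T (fun _ _ => unit) (fun _ => tt) (fun _ _ _ _ _ => tt) _ _ _.
Next Obligation. by move=> T a b []. Qed.
Next Obligation. by move=> T a b []. Qed.

Program Definition chaotic_functor (C : category) (T : Type) (f : C -> T) :
    functor C (chaotic T) :=
  @Functor C (chaotic T) f (fun _ _ _ => tt) _ _.

Lemma functor_chaotic_eq (C : category) (T : Type) (F H : functor C (chaotic T)) :
  (forall a, F a = H a) -> F = H.
Proof.
case: F H => [f m p q] [f' m' p' q'] /= eqf.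
have {eqf} E : f = f' by exact: funext.
subst f'.
have E : m = m'.
  apply: functional_extensionality_dep => a.
  apply: functional_extensionality_dep => b.
  by apply: functional_extensionality_dep => h; case: (m a b h); case: (m' a b h).
by subst m'; congr Functor; exact: Prop_irrelevance.
Qed.

Lemma functor_comp_assoc (A B C D : category) (F : functor C D)
    (H : functor B C) (K : functor A B) :
  functor_comp (functor_comp F H) K = functor_comp F (functor_comp H K).
Proof. by rewrite /functor_comp; congr Functor; exact: Prop_irrelevance. Qed.

Lemma functor_comp_idl (A B : category) (F : functor A B) :
  functor_comp (functor_id B) F = F.
Proof.
by case: F => f m p q; rewrite /functor_comp /=; congr Functor;
  exact: Prop_irrelevance.
Qed.

Lemma functor_comp_idr (A B : category) (F : functor A B) :
  functor_comp F (functor_id A) = F.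
Proof.
by case: F => f m p q; rewrite /functor_comp /=; congr Functor;
  exact: Prop_irrelevance.
Qed.

(* The poset [n] = {0 < ... < n}; functors [m] -> [n] are the simplicial
   operators. *)
Program Definition ordinal_category (n : nat) : category :=
  @Category 'I_n.+1 (fun i j => (i <= j)%N) (fun i => leqnn i)
    (fun _ _ _ f g => leq_trans f g) _ _ _.

Definition nerve (C : category) (n : nat) : Type :=
  functor (ordinal_category n) C.

Definition simplex (R : realType) (n : nat) : set 'rV[R]_n.+1 :=
  [set t | (forall i, 0 <= t ord0 i)%R /\ (\sum_i t ord0 i = 1)%R].

Definition simplex_push (R : realType) (m n : nat)
    (theta : functor (ordinal_category m) (ordinal_category n))
    (t : 'rV[R]_m.+1) : 'rV[R]_n.+1 :=
  (\row_i \sum_(k < m.+1 | theta k == i) t ord0 k)%R.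

Section Realization.
Variable R : realType.

Definition cells (C : category) : topologicalType :=
  {n : nat & (discrete_topology {classic nerve C n} *
              set_type (@simplex R n))%type}.

Definition cell (C : category) n (x : nerve C n) (t : set_type (@simplex R n)) :
    cells C :=
  existT _ n ((x : discrete_topology {classic nerve C n}), t).

Inductive glue (C : category) : cells C -> cells C -> Prop :=
  Glue m n (theta : functor (ordinal_category m) (ordinal_category n))
      (x : nerve C n) t t' :
    set_val t' = simplex_push theta (set_val t) ->
    glue (cell (functor_comp x theta) t) (cell x t').

Definition glue_eq (C : category) (a b : cells C) : bool :=
  `[< clos_refl_sym_trans _ (@glue C) a b >].

Lemma glue_eq_refl C : reflexive (@glue_eq C).
Proof. by move=> a; apply/asboolP; exact: rst_refl. Qed.
Lemma glue_eq_sym C : symmetric (@glue_eq C).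
Proof. by move=> a b; apply/idP/idP => /asboolP H; apply/asboolP; exact: rst_sym. Qed.
Lemma glue_eq_trans C : transitive (@glue_eq C).
Proof.
by move=> b a c /asboolP H1 /asboolP H2; apply/asboolP; exact: rst_trans H1 H2.
Qed.

Canonical glue_equiv C :=
  EquivRel (@glue_eq C) (@glue_eq_refl C) (@glue_eq_sym C) (@glue_eq_trans C).

Definition classifying_space (C : category) : topologicalType :=
  quotient_topology {eq_quot (glue_equiv C)}.


Definition cell_map (C D : category) (F : functor C D) (a : cells C) : cells D :=
  let: existT n (x, t) := a in
  cell (functor_comp F (x : functor (ordinal_category n) C)) t.

Lemma cell_map_glue C D (F : functor C D) (a b : cells C) :
  glue_eq a b -> glue_eq (cell_map F a) (cell_map F b).
Proof.
move=> /asboolP H; apply/asboolP.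
elim: {a b} H => [a b [m n theta x t t' tE]|a|a b _ IH|a b c _ IH1 _ IH2].
- by rewrite /= -functor_comp_assoc; apply: rst_step; exact: Glue.
- exact: rst_refl.
- exact: rst_sym.
- exact: rst_trans IH1 IH2.
Qed.

Definition space_map (C D : category) (F : functor C D) :
    classifying_space C -> classifying_space D :=
  fun z => \pi_(classifying_space D) (cell_map F (repr z)).

Lemma space_map_pi C D (F : functor C D) (a : cells C) :
  space_map F (\pi_(classifying_space C) a) =
  \pi_(classifying_space D) (cell_map F a).
Proof.
apply/eqmodP; apply: cell_map_glue.
by have /eqmodP := reprK (\pi_(classifying_space C) a).
Qed.

Lemma cell_map_continuous C D (F : functor C D) : continuous (@cell_map C D F).
Proof.
move=> -[n p].
pose f (q : (discrete_topology {classic nerve C n} *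
    set_type (@simplex R n))%type) : (discrete_topology {classic nerve D n} *
    set_type (@simplex R n))%type :=
  (functor_comp F (q.1 : functor (ordinal_category n) C), q.2).
have fE : cell_map F \o existT _ n = existT _ n \o f.
  by apply: funext => -[x t].
suff : (cell_map F \o existT _ n) @ p --> cell_map F (existT _ n p) by [].
rewrite fE -[cell_map F _]/((cell_map F \o existT _ n) p) fE.
apply: continuous_comp; last exact: existT_continuous.
apply: (@cvg_pair _ _ _ _ (nbhs (f p).1) (nbhs (f p).2)).
- move=> A /nbhs_singleton Ap.
  have pE : \forall q \near p, q.1 = p.1.
    have cf : fst @ p --> p.1 by exact: cvg_fst.
    exact: (cf _ (discrete_set1 p.1)).
  suff : \forall q \near p, A (f q).1 by [].
  by apply: filterS pE => q qE; rewrite /f /= qE.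
- exact: cvg_snd.
Qed.

Lemma space_map_continuous C D (F : functor C D) : continuous (space_map F).
Proof.
apply/quotient_continuous.
have -> : space_map F \o \pi_(classifying_space C) =
          \pi_(classifying_space D) \o @cell_map C D F.
  by apply: funext => a; exact: space_map_pi.
by move=> a; apply: continuous_comp;
  [exact: cell_map_continuous|exact: pi_continuous].
Qed.

Lemma space_map_id C (z : classifying_space C) : space_map (functor_id C) z = z.
Proof.
rewrite -[z in LHS]reprK space_map_pi -[RHS]reprK; congr (\pi _).
by case: (repr z) => n [x t]; rewrite /cell_map functor_comp_idl.
Qed.

Lemma space_map_comp C D E (F : functor D E) (H : functor C D)
    (z : classifying_space C) :
  space_map (functor_comp F H) z = space_map F (space_map H z).
Proof.
rewrite -[z]reprK; move: (repr z) => a.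
rewrite (space_map_pi (functor_comp F H)) (space_map_pi H a) space_map_pi.
apply: (congr1 \pi_(classifying_space E)).
by case: a => n [x t]; rewrite /= functor_comp_assoc.
Qed.

End Realization.

Record gspace (K : finGroupType) := GSpace {
  gspace_sort :> topologicalType;
  gspace_act : K -> gspace_sort -> gspace_sort;
  gspace_act1 : forall x, gspace_act 1%g x = x;
  gspace_actM : forall g h x,
    gspace_act (g * h)%g x = gspace_act g (gspace_act h x);
  gspace_act_continuous : forall g, continuous (gspace_act g) }.

Record gcategory (K : finGroupType) := GCategory {
  gcat_sort :> category;
  gcat_act : K -> functor gcat_sort gcat_sort;
  gcat_act1 : gcat_act 1%g = functor_id gcat_sort;
  gcat_actM : forall g h,
    gcat_act (g * h)%g = functor_comp (gcat_act g) (gcat_act h) }.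

Program Definition classifying_gspace (R : realType) (K : finGroupType)
    (C : gcategory K) : gspace K :=
  @GSpace K (classifying_space R C) (fun g => space_map (gcat_act C g)) _ _ _.
Next Obligation. by move=> R K C z /=; rewrite gcat_act1 space_map_id. Qed.
Next Obligation. by move=> R K C g h z /=; rewrite gcat_actM space_map_comp. Qed.
Next Obligation. by move=> R K C g; exact: space_map_continuous. Qed.

Definition fixed_points (K : finGroupType) (E : gspace K) (L : {set K}) : set E :=
  [set x | forall l, l \in L -> gspace_act l x = x].

Definition contractible (R : realType) (T : topologicalType) : Prop :=
  exists (x0 : T) (h : T * R -> T),
    [/\ {within [set: T] `*` `[0%R, 1%R], continuous h},
        forall x, h (x, 0%R) = x & forall x, h (x, 1%R) = x0].

Definition G_contractible (R : realType) (K : finGroupType) (E : gspace K) : Prop :=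
  exists (x0 : E) (h : E * R -> E),
    [/\ {within [set: E] `*` `[0%R, 1%R], continuous h},
        forall x, h (x, 0%R) = x, forall x, h (x, 1%R) = x0,
        forall g, gspace_act g x0 = x0 &
        forall g x t, (0 <= t <= 1)%R ->
          h (gspace_act g x, t) = gspace_act g (h (x, t))].

Arguments fixed_points {K} E L.

(* [L] meets the subgroup 'S_j of gT * 'S_j in the identity only. *)
Definition sigma_trivial (gT : finGroupType) (j : nat)
    (L : {group gT * 'S_j}) : Prop :=
  forall s : 'S_j, (1%g, s) \in L -> s = 1%g.

Definition universal_principal_bundle (R : realType) (gT : finGroupType)
    (j : nat) (E : gspace (gT * 'S_j)%type) : Prop :=
  forall L : {group gT * 'S_j},
    (sigma_trivial L -> contractible R (set_type (fixed_points E L))) /\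
    (~ sigma_trivial L -> fixed_points E L = set0).

Lemma sum_single (j : nat) : j = \sum_(i < 1) j.
Proof. by rewrite big_ord1. Qed.

Lemma sum_ones (k : nat) : k = \sum_(i < k) 1.
Proof. by rewrite sum1_card card_ord. Qed.

Lemma sum_assoc (k : nat) (j : 'I_k -> nat) (i : 'I_(\sum_s j s) -> nat) :
  \sum_s \sum_(l < j s) i (tagnat.Rank s l) = \sum_t i t.
Proof.
rewrite (reindex (@tagnat.rank k j)) /=; last exact: tagnat.rank_bij_on.
by rewrite sig_big_dep; apply: eq_bigr => p _; rewrite tagnat.rankE.
Qed.

Lemma sum_perm (k : nat) (j : 'I_k -> nat) (s : 'S_k) :
  \sum_i j i = \sum_i j (s i).
Proof. by rewrite (reindex_inj (@perm_inj _ s)). Qed.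

Definition arity_cast (E : nat -> Type) (m n : nat) (e : m = n) (x : E m) : E n :=
  eq_rect m E x n e.

Section BlockPermutations.
Variables (k : nat) (j : 'I_k -> nat).

Definition block_perm_fun (s : 'S_k) (t : 'I_(\sum_i j (s i))) :
    'I_(\sum_i j (s i)) :=
  cast_ord (sum_perm j s)
    (tagnat.Rank (s (tagnat.sig1 t)) (tagnat.sig2 t)).

Lemma block_perm_inj s : injective (@block_perm_fun s).
Proof.
move=> t t' /cast_ord_inj /(congr1 val) /eqP; rewrite tagnat.eq_Rank.
move=> /andP[/eqP /perm_inj E1 /eqP E2]; rewrite -(tagnat.sig2K t).
by rewrite -(tagnat.sig2K t'); apply/val_inj/eqP;
  rewrite tagnat.eq_Rank; apply/andP; split; apply/eqP.
Qed.

(* s(j_1, ..., j_k): permutes the k blocks, of sizes j (s 1), ..., j (s k), as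
   s permutes letters. *)
Definition block_perm (s : 'S_k) : 'S_(\sum_i j (s i)) :=
  perm (@block_perm_inj s).

Definition block_sum_fun (s : forall i, 'S_(j i)) (t : 'I_(\sum_i j i)) :
    'I_(\sum_i j i) :=
  tagnat.Rank (tagnat.sig1 t) (s (tagnat.sig1 t) (tagnat.sig2 t)).

Lemma block_sum_inj s : injective (block_sum_fun s).
Proof.
move=> t t' /(congr1 val) /eqP; rewrite tagnat.eq_Rank => /andP[/eqP E1 E2].
rewrite -[LHS]tagnat.sig2K -[RHS]tagnat.sig2K.
move: (tagnat.sig2 t) (tagnat.sig2 t') E2; rewrite -E1 => a b /eqP E2.
by congr tagnat.Rank; apply: (@perm_inj _ (s (tagnat.sig1 t))); apply: val_inj.
Qed.

Definition block_sum (s : forall i, 'S_(j i)) : 'S_(\sum_i j i) :=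
  perm (@block_sum_inj s).

End BlockPermutations.

(* The operad axioms, together with the compatibility of all the structure with
   the left action [act] of the group. The product of 'S_n is reversed
   composition, [(s * t) x = t (s x)], hence the form of [sym_M] for the right
   action [sym] of the symmetric group (with composition as its product).
   In [gam_symc] the substitution d_i := d_(s i) makes the usual
   gamma(c s; d_1, ..., d_k) = gamma(c; d_(s^-1 1), ..., d_(s^-1 k)) s(j_1, ..., j_k)
   free of inverses. *)
Record operad_axioms (gT : finGroupType) (E : nat -> Type)
    (act : forall n, gT -> E n -> E n) (sym : forall n, E n -> 'S_n -> E n)
    (one : E 1)
    (gam : forall k (j : 'I_k -> nat), E k -> (forall i, E (j i)) ->
       E (\sum_i j i)) : Prop := OperadAxioms {
  act_1 : forall n (c : E n), act n 1%g c = c;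
  act_M : forall n g h (c : E n), act n (g * h)%g c = act n g (act n h c);
  sym_1 : forall n (c : E n), sym n c 1%g = c;
  sym_M : forall n (c : E n) s t, sym n c (t * s)%g = sym n (sym n c s) t;
  act_sym : forall n g (c : E n) s, act n g (sym n c s) = sym n (act n g c) s;
  act_one : forall g, act 1 g one = one;
  act_gam : forall g k j c d,
    act _ g (gam k j c d) = gam k j (act k g c) (fun i => act (j i) g (d i));
  gam_one_l : forall j (d : E j),
    gam 1 (fun=> j) one (fun=> d) = arity_cast (sum_single j) d;
  gam_one_r : forall k (c : E k),
    gam k (fun=> 1) c (fun=> one) = arity_cast (sum_ones k) c;
  gam_assoc : forall k (j : 'I_k -> nat) (i : 'I_(\sum_s j s) -> nat)
      (c : E k) (d : forall s, E (j s)) (e : forall t, E (i t)),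
    gam _ i (gam k j c d) e =
    arity_cast (sum_assoc i)
      (gam k (fun s => \sum_(l < j s) i (tagnat.Rank s l)) c
        (fun s => gam (j s) (fun l => i (tagnat.Rank s l)) (d s)
          (fun l => e (tagnat.Rank s l))));
  gam_symc : forall k (j : 'I_k -> nat) (c : E k) (d : forall i, E (j i))
      (s : 'S_k),
    gam k (fun i => j (s i)) (sym k c s) (fun i => d (s i)) =
    sym _ (arity_cast (sum_perm j s) (gam k j c d)) (block_perm j s);
  gam_symd : forall k (j : 'I_k -> nat) (c : E k) (d : forall i, E (j i))
      (s : forall i, 'S_(j i)),
    gam k j c (fun i => sym (j i) (d i) (s i)) =
    sym _ (gam k j c d) (block_sum s) }.

(* An operad in the category of G-sets. *)
Record set_operad (gT : finGroupType) := SetOperad {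
  sop_ob :> nat -> Type;
  sop_act : forall n, gT -> sop_ob n -> sop_ob n;
  sop_sym : forall n, sop_ob n -> 'S_n -> sop_ob n;
  sop_one : sop_ob 1;
  sop_gam : forall k (j : 'I_k -> nat),
    sop_ob k -> (forall i, sop_ob (j i)) -> sop_ob (\sum_i j i);
  sop_axioms : operad_axioms sop_act sop_sym sop_one sop_gam }.

(* An operad in the category of G-categories. The axioms are equalities of
   functors; they are stated on generalized elements, that is, on functors from
   an arbitrary category X. *)
Record cat_operad (gT : finGroupType) := CatOperad {
  cop_cat :> nat -> category;
  cop_act : forall n, gT -> functor (cop_cat n) (cop_cat n);
  cop_sym : forall n, 'S_n -> functor (cop_cat n) (cop_cat n);
  cop_one : cop_cat 1;
  cop_gam : forall k (j : 'I_k -> nat),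
    functor
      (prod_category (cop_cat k) (pi_category (fun i => cop_cat (j i))))
      (cop_cat (\sum_i j i));
  cop_axioms : forall X : category,
    @operad_axioms gT (fun n => functor X (cop_cat n))
      (fun n g F => functor_comp (cop_act n g) F)
      (fun n F s => functor_comp (cop_sym s) F)
      (functor_const X cop_one)
      (fun k j c d =>
        functor_comp (cop_gam j) (functor_pair c (functor_tuple d))) }.

Program Definition operad_gcategory (gT : finGroupType) (O : cat_operad gT)
    (n : nat) : gcategory gT :=
  @GCategory gT (O n) (fun g => cop_act O n g) _ _.
Next Obligation.
move=> gT O n; have := act_1 (cop_axioms O (O n)) (functor_id (O n)).
by rewrite functor_comp_idr.
Qed.
Next Obligation.
move=> gT O n g h; have := act_M (cop_axioms O (O n)) g h (functor_id (O n)).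
by rewrite !functor_comp_idr.
Qed.

(* The left (G x Sigma_j)-action (g, s) c = g c s^-1, transported along the
   isomorphism s |-> s^-1 from Sigma_j, with composition as its product, to the
   group 'S_j, whose product is reversed composition. *)
Program Definition operad_sigma_gcategory (gT : finGroupType)
    (O : cat_operad gT) (n : nat) : gcategory (gT * 'S_n)%type :=
  @GCategory (gT * 'S_n)%type (O n)
    (fun gs => functor_comp (cop_act O n gs.1) (cop_sym O gs.2)) _ _.
Next Obligation.
move=> gT O n /=; have A := cop_axioms O (O n).
have := sym_1 A (functor_id (O n)); rewrite functor_comp_idr => ->.
exact: (act_1 A (functor_id (O n))).
Qed.
Next Obligation.
move=> gT O n [g s] [h t] /=; have A := cop_axioms O (O n).
have symM := sym_M A (functor_id (O n)) t s.
have actM := act_M A g h (functor_id (O n)).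
have com := act_sym A h (functor_id (O n)) s.
rewrite !functor_comp_idr in symM actM com.
by rewrite symM actM !functor_comp_assoc -(functor_comp_assoc (cop_sym O s)) -com
  !functor_comp_assoc.
Qed.

Definition E_infty_operad (R : realType) (gT : finGroupType)
    (O : cat_operad gT) : Prop :=
  G_contractible R (classifying_gspace R (operad_gcategory O 0)) /\
  forall j, (0 < j)%N ->
    universal_principal_bundle R
      (classifying_gspace R (operad_sigma_gcategory O j)).

(* The operad of chaotic categories with given objects. *)
Section ChaoticOperad.
Variables (gT : finGroupType) (O : set_operad gT).

Lemma chaotic_castE (X : category) m n (e : m = n)
    (F : functor X (chaotic (O m))) x :
  arity_cast (E := fun n => functor X (chaotic (O n))) e F x =
  arity_cast e (F x) :> O n.
Proof. by case: n / e. Qed.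

Program Definition chaotic_operad : cat_operad gT :=
  @CatOperad gT (fun n => chaotic (O n))
    (fun n g => chaotic_functor (C := chaotic (O n)) (@sop_act _ O n g))
    (fun n s => chaotic_functor (C := chaotic (O n)) (fun c => sop_sym c s))
    (sop_one O)
    (fun k j => chaotic_functor
       (C := prod_category (chaotic (O k)) (pi_category (fun i => chaotic (O (j i)))))
       (fun cd => sop_gam (cd.1 : O k) (cd.2 : forall i, O (j i)))) _.
Next Obligation.
have A := sop_axioms O.
move=> X; split=> *; apply: functor_chaotic_eq => x;
  rewrite ?chaotic_castE /= ?chaotic_castE.
- exact: act_1 A _ _.
- exact: act_M A _ _ _ _.
- exact: sym_1 A _ _.
- exact: sym_M A _ _ _ _.
- exact: act_sym A _ _ _ _.
- exact: act_one A _.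
- exact: act_gam A _ _ _ _ _.
- exact: gam_one_l A _ _.
- exact: gam_one_r A _ _.
- exact: gam_assoc A _ _ _ _ _ _.
- exact: gam_symc A _ _ _ _ _.
- exact: gam_symd A _ _ _ _ _.
Qed.

End ChaoticOperad.

Lemma sval_inj (T : Type) (P : T -> Prop) (x y : {c | P c}) :
  sval x = sval y -> x = y.
Proof. by case: x y => [x p] [y q] /= E; exact: eq_exist. Qed.

Section SubOperad.
Variables (gT : finGroupType) (O : set_operad gT) (P : forall n, O n -> Prop).

Record operad_closed : Prop := OperadClosed {
  closed_act : forall n g (c : O n), P c -> P (sop_act g c);
  closed_sym : forall n (c : O n) s, P c -> P (sop_sym c s);
  closed_one : P (sop_one O);
  closed_gam : forall k (j : 'I_k -> nat) (c : O k) (d : forall i, O (j i)),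
    P c -> (forall i, P (d i)) -> P (sop_gam c d) }.

Hypothesis PO : operad_closed.
Local Notation E := (fun n => {c : O n | P c}).

Lemma sub_castE m n (e : m = n) (c : E m) :
  sval (arity_cast (E := E) e c) = arity_cast e (sval c).
Proof. by case: n / e. Qed.

Program Definition sub_set_operad : set_operad gT :=
  @SetOperad gT E
    (fun n g c => exist _ (sop_act g (sval c)) (closed_act PO g (svalP c)))
    (fun n c s => exist _ (sop_sym (sval c) s) (closed_sym PO s (svalP c)))
    (exist _ (sop_one O) (closed_one PO))
    (fun k j c d => exist _ (sop_gam (sval c) (fun i => sval (d i)))
       (closed_gam PO (svalP c) (fun i => svalP (d i)))) _.
Next Obligation.
have A := sop_axioms O.
split=> *; apply: sval_inj; rewrite ?sub_castE /= ?sub_castE.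
- exact: act_1 A _ _.
- exact: act_M A _ _ _ _.
- exact: sym_1 A _ _.
- exact: sym_M A _ _ _ _.
- exact: act_sym A _ _ _ _.
- exact: act_one A _.
- exact: act_gam A _ _ _ _ _.
- exact: gam_one_l A _ _.
- exact: gam_one_r A _ _.
- exact: gam_assoc A _ _ _ _ _ _.
- exact: gam_symc A _ _ _ _ _.
- exact: gam_symd A _ _ _ _ _.
Qed.

End SubOperad.

Record gset (gT : finGroupType) := GSet {
  gset_sort :> Type;
  gset_act : gT -> gset_sort -> gset_sort;
  gset_act1 : forall u, gset_act 1%g u = u;
  gset_actM : forall g h u, gset_act (g * h)%g u = gset_act g (gset_act h u) }.

(* [iota n] is a G-map from the left cosets of H to U. *)
Definition contains_copies (gT : finGroupType) (U : gset gT)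
    (H : {group gT}) : Prop :=
  exists iota : nat -> {set gT} -> U,
    (forall n g A, A \in lcosets H [set: gT]%SET ->
       iota n (g *: A)%g = gset_act g (iota n A)) /\
    (forall n m A B, A \in lcosets H [set: gT]%SET ->
       B \in lcosets H [set: gT]%SET ->
       iota n A = iota m B -> n = m /\ A = B).

Definition universe_gset (gT : finGroupType) (U : gset gT) : Prop :=
  countable [set: U] /\ forall H : {group gT}, contains_copies U H.

Lemma gset_act_inj (gT : finGroupType) (U : gset gT) (g : gT) :
  injective (@gset_act gT U g).
Proof.
by move=> u v E; rewrite -(gset_act1 u) -(gset_act1 v) -(mulVg g) !gset_actM E.
Qed.

Lemma rank_lt (k : nat) (j : 'I_k -> nat) (s s' : 'I_k) (l : 'I_(j s))
    (l' : 'I_(j s')) :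
  (tagnat.Rank s' l' < tagnat.Rank s l)%N =
  (s' < s)%N || ((s' == s) && (l' < l)%N).
Proof.
rewrite -[LHS]/(tagnat.Rank s' l' < tagnat.Rank s l)%O /tagnat.Rank tagnat.lt_rank ltEsig /= leEord ltEord.
case: (ltngtP s' s) => //= [lt|/val_inj E]; first by rewrite -val_eqE gtn_eqF.
by subst s'; rewrite eqxx tagged_asE.
Qed.

Lemma cast_rank_assoc (k : nat) (j : 'I_k -> nat) (i : 'I_(\sum_s j s) -> nat)
    (s : 'I_k) (l : 'I_(j s)) (r : 'I_(i (tagnat.Rank s l))) :
  cast_ord (sum_assoc i) (tagnat.Rank s (tagnat.Rank l r)) =
  tagnat.Rank (tagnat.Rank s l) r.
Proof.
apply: ord_inj; transitivity (nat_of_ord (@tagnat.Rank k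
  (fun s => \sum_(l < j s) i (tagnat.Rank s l)) s (tagnat.Rank l r))) => //.
rewrite [LHS]tagnat.RankEsum [X in _ + X = _]tagnat.RankEsum [RHS]tagnat.RankEsum.
rewrite addnA; congr addn.
rewrite [RHS](reindex (@tagnat.rank k j)); last exact/onW_bij/tagnat.rank_bij.
rewrite (eq_bigr (fun p => i (tagnat.Rank (tag p) (tagged p)))); last first.
  by move=> p _; rewrite (tagnat.rankE p).
rewrite (eq_bigl (fun p : {x : 'I_k & 'I_(j x)} =>
  predT (tag p) && (tagnat.Rank (tag p) (tagged p) < tagnat.Rank s l)%N));
  last by move=> p; rewrite (tagnat.rankE p).
rewrite -(sig_big_dep _ (fun x y => (tagnat.Rank x y < tagnat.Rank s l)%N)
  (fun x y => i (tagnat.Rank x y))) /=.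
rewrite [RHS](bigID (fun x : 'I_k => (x < s)%N)) /=; congr addn.
  apply: eq_bigr => s' lt; apply: eq_bigl => l'.
  by rewrite rank_lt lt.
rewrite [RHS](bigD1 s) ?ltnn //= [X in _ = _ + X]big1 ?addn0.
  by apply: eq_bigl => l'; rewrite rank_lt ltnn eqxx.
move=> s' /andP[ge ne]; apply: big1 => l'.
by rewrite rank_lt (negPf ge) (negPf ne).
Qed.

Lemma sig_Rank (k : nat) (j : 'I_k -> nat) (T : Type)
    (F : forall i, 'I_(j i) -> T) (i : 'I_k) (l : 'I_(j i)) :
  F (tagnat.sig1 (tagnat.Rank i l)) (tagnat.sig2 (tagnat.Rank i l)) = F i l.
Proof.
rewrite tagnat.Rank2K.
move: (tagnat.Rank1K l) => E; move: (congr1 _ _).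
move: (tagnat.sig1 _) E => i' E; case: _ / E in l * => e.
by congr F; apply: val_inj.
Qed.

Lemma block_permE (k : nat) (j : 'I_k -> nat) (s : 'S_k) i (l : 'I_(j (s i))) :
  block_perm j s (tagnat.Rank i l) =
  cast_ord (sum_perm j s) (tagnat.Rank (s i) l).
Proof.
rewrite permE /block_perm_fun; congr cast_ord.
exact: (sig_Rank (fun i (l : 'I_(j (s i))) => @tagnat.Rank k j (s i) l)).
Qed.

Lemma block_sumE (k : nat) (j : 'I_k -> nat) (s : forall i, 'S_(j i)) i
    (l : 'I_(j i)) :
  block_sum s (tagnat.Rank i l) = tagnat.Rank i (s i l).
Proof.
rewrite permE /block_sum_fun.
exact: (sig_Rank (fun i (l : 'I_(j i)) => @tagnat.Rank k j i (s i l))).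
Qed.

Lemma RankP (k : nat) (j : 'I_k -> nat) (P : 'I_(\sum_i j i) -> Prop) :
  (forall i (l : 'I_(j i)), P (tagnat.Rank i l)) -> forall t, P t.
Proof. by move=> H t; rewrite -(tagnat.sig2K t). Qed.

Lemma Rank_single (j : nat) (l : 'I_j) :
  tagnat.Rank ord0 l = cast_ord (sum_single j) l.
Proof.
apply: ord_inj; by rewrite [LHS]tagnat.RankEsum [X in X + _ = _]big_pred0.
Qed.

Lemma Rank_ones (k : nat) (i : 'I_k) :
  @tagnat.Rank k (fun=> 1) i ord0 = cast_ord (sum_ones k) i.
Proof.
apply: ord_inj; rewrite [LHS]tagnat.RankEsum addn0.
by rewrite -[LHS](big_ord_widen k (fun=> 1) (ltnW (ltn_ord i))) [LHS]sum1_card card_ord.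
Qed.

Section Injections.
Variables (gT : finGroupType) (U : gset gT).
Local Notation "g # u" := (gset_act g u) (at level 40).

(* The disjoint union of n copies of U is 'I_n * U. *)
Definition sum_inj (n : nat) : Type := {f : 'I_n * U -> U | injective f}.

Program Definition sum_inj_act n (g : gT) (f : sum_inj n) : sum_inj n :=
  exist _ (fun x => g # sval f (x.1, g^-1%g # x.2)) _.
Next Obligation.
move=> n g [f fi] [i u] [i' u'] /= /gset_act_inj /fi [-> /gset_act_inj ->].
by [].
Qed.

Program Definition sum_inj_sym n (f : sum_inj n) (s : 'S_n) : sum_inj n :=
  exist _ (fun x => sval f (s x.1, x.2)) _.
Next Obligation. by move=> n [f fi] s [i u] [i' u'] /= /fi [/perm_inj -> ->]. Qed.

Program Definition sum_inj_one : sum_inj 1 := exist _ snd _.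
Next Obligation. by move=> [i u] [i' u'] /= ->; rewrite (ord1 i) (ord1 i'). Qed.

Program Definition sum_inj_gam k (j : 'I_k -> nat) (c : sum_inj k)
    (d : forall i, sum_inj (j i)) : sum_inj (\sum_i j i) :=
  exist _ (fun x => sval c (tagnat.sig1 x.1,
     sval (d (tagnat.sig1 x.1)) (tagnat.sig2 x.1, x.2))) _.
Next Obligation.
move=> k j [c ci] d [t u] [t' u'] /= /ci [E1 E2].
suff [-> ->] : t = t' /\ u = u' by [].
rewrite -[t]tagnat.sig2K -[t']tagnat.sig2K.
move: (tagnat.sig2 t) (tagnat.sig2 t') E2; rewrite -E1 => a b.
by move=> /(svalP (d (tagnat.sig1 t))) [-> ->].
Qed.

Lemma sum_inj_gamE k (j : 'I_k -> nat) (c : sum_inj k)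
    (d : forall i, sum_inj (j i)) i (l : 'I_(j i)) (u : U) :
  sval (sum_inj_gam c d) (tagnat.Rank i l, u) = sval c (i, sval (d i) (l, u)).
Proof.
exact: (sig_Rank (fun i (l : 'I_(j i)) => sval c (i, sval (d i) (l, u)))).
Qed.

Lemma sum_inj_castE m n (e : m = n) (f : sum_inj m) (t : 'I_m) (u : U) :
  sval (arity_cast e f) (cast_ord e t, u) = sval f (t, u).
Proof. by case: n / e; rewrite cast_ord_id. Qed.

Lemma sum_inj_symE n (f : sum_inj n) (s : 'S_n) (t : 'I_n) (u : U) :
  sval (sum_inj_sym f s) (t, u) = sval f (s t, u).
Proof. by []. Qed.

Lemma sum_inj_axioms :
  operad_axioms sum_inj_act sum_inj_sym sum_inj_one sum_inj_gam.
Proof.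
split.
- move=> n c; apply: sval_inj; apply: funext => -[i u] /=.
  by rewrite invg1 !gset_act1.
- move=> n g h c; apply: sval_inj; apply: funext => -[i u] /=.
  by rewrite invMg !gset_actM.
- move=> n c; apply: sval_inj; apply: funext => -[i u] /=.
  by rewrite perm1.
- move=> n c s t; apply: sval_inj; apply: funext => -[i u] /=.
  by rewrite permM.
- by move=> n g c s; apply: sval_inj.
- move=> g; apply: sval_inj; apply: funext => -[i u] /=.
  by rewrite -gset_actM mulgV gset_act1.
- move=> g k j c d; apply: sval_inj; apply: funext => -[i u] /=.
  by rewrite -gset_actM mulVg gset_act1.
- move=> j d; apply: sval_inj; apply: funext => -[t u].
  elim/RankP: t => i l; rewrite sum_inj_gamE (ord1 i) Rank_single.
  by rewrite sum_inj_castE.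
- move=> k c; apply: sval_inj; apply: funext => -[t u].
  elim/RankP: t => i l; rewrite sum_inj_gamE (ord1 l) Rank_ones.
  by rewrite sum_inj_castE.
- move=> k j i c d e; apply: sval_inj; apply: funext => -[t u].
  elim/RankP: t => t; elim/RankP: t => s l r.
  by rewrite -cast_rank_assoc sum_inj_castE cast_rank_assoc !sum_inj_gamE.
- move=> k j c d s; apply: sval_inj; apply: funext => -[t u].
  elim/RankP: t => i l; rewrite sum_inj_gamE !sum_inj_symE block_permE.
  by rewrite sum_inj_castE sum_inj_gamE.
- move=> k j c d s; apply: sval_inj; apply: funext => -[t u].
  elim/RankP: t => i l; rewrite sum_inj_gamE !sum_inj_symE block_sumE.
  by rewrite sum_inj_gamE.
Qed.

Definition sum_inj_operad : set_operad gT := SetOperad sum_inj_axioms.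

Definition prod_inj (n : nat) : Type := {f : ('I_n -> U) -> U | injective f}.

Program Definition prod_inj_act n (g : gT) (f : prod_inj n) : prod_inj n :=
  exist _ (fun x => g # sval f (fun i => g^-1%g # x i)) _.
Next Obligation.
move=> n g [f fi] x y /= /gset_act_inj /fi E; apply: funext => i.
by move/(congr1 (@^~ i)): E => /gset_act_inj.
Qed.

(* The left action of a permutation s on the product sends x to
   i |-> x (s^-1 i). *)
Program Definition prod_inj_sym n (f : prod_inj n) (s : 'S_n) : prod_inj n :=
  exist _ (fun x => sval f (fun i => x (s^-1%g i))) _.
Next Obligation.
move=> n [f fi] s x y /= /fi E; apply: funext => i.
by move/(congr1 (@^~ (s i))): E; rewrite permK.
Qed.

Program Definition prod_inj_one : prod_inj 1 := exist _ (fun x => x ord0) _.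
Next Obligation. by move=> x y /= E; apply: funext => i; rewrite (ord1 i). Qed.

Program Definition prod_inj_gam k (j : 'I_k -> nat) (c : prod_inj k)
    (d : forall i, prod_inj (j i)) : prod_inj (\sum_i j i) :=
  exist _ (fun x => sval c (fun i =>
     sval (d i) (fun l => x (tagnat.Rank i l)))) _.
Next Obligation.
move=> k j [c ci] d x y /= /ci E; apply: funext => t.
rewrite -[t]tagnat.sig2K; move/(congr1 (@^~ (tagnat.sig1 t))): E.
by move=> /(svalP (d _)) /(congr1 (@^~ (tagnat.sig2 t))).
Qed.

Lemma prod_inj_castE m n (e : m = n) (f : prod_inj m) (x : 'I_n -> U) :
  sval (arity_cast e f) x = sval f (fun i => x (cast_ord e i)).
Proof.
case: n / e x => x /=; congr (sval f _); apply: funext => i.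
by rewrite cast_ord_id.
Qed.

Lemma prod_inj_axioms :
  operad_axioms prod_inj_act prod_inj_sym prod_inj_one prod_inj_gam.
Proof.
split.
- move=> n c; apply: sval_inj; apply: funext => x /=.
  by rewrite gset_act1; congr (sval c _); apply: funext => i; rewrite invg1 gset_act1.
- move=> n g h c; apply: sval_inj; apply: funext => x /=.
  rewrite gset_actM; congr (gset_act _ (gset_act _ (sval c _))).
  by apply: funext => i; rewrite invMg gset_actM.
- move=> n c; apply: sval_inj; apply: funext => x /=.
  by congr (sval c _); apply: funext => i; rewrite invg1 perm1.
- move=> n c s t; apply: sval_inj; apply: funext => x /=.
  by congr (sval c _); apply: funext => i; rewrite invMg permM.
- by move=> n g c s; apply: sval_inj.
- move=> g; apply: sval_inj; apply: funext => x /=.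
  by rewrite -gset_actM mulgV gset_act1.
- move=> g k j c d; apply: sval_inj; apply: funext => x /=.
  congr (gset_act _ (sval c _)); apply: funext => i.
  by rewrite -gset_actM mulVg gset_act1.
- move=> j d; apply: sval_inj; apply: funext => x; rewrite prod_inj_castE /=.
  by congr (sval d _); apply: funext => l; rewrite -Rank_single.
- move=> k c; apply: sval_inj; apply: funext => x; rewrite prod_inj_castE /=.
  by congr (sval c _); apply: funext => l; rewrite -Rank_ones.
- move=> k j i c d e; apply: sval_inj; apply: funext => x.
  rewrite prod_inj_castE; congr (sval c _); apply: funext => s.
  congr (sval (d s) _); apply: funext => l.
  by congr (sval (e _) _); apply: funext => r; rewrite cast_rank_assoc.
- move=> k j c d s; apply: sval_inj; apply: funext => x.
  rewrite [RHS]prod_inj_castE; congr (sval c _); apply: funext => i'.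
  have [i ->] : exists i, i' = s i by exists (s^-1%g i'); rewrite permKV.
  pose F i := sval (d (s i)) (fun l => x (tagnat.Rank i l)).
  rewrite -[LHS]/(F (s^-1%g (s i))) permK.
  by congr (sval _ _); apply: funext => l; rewrite -block_permE permK.
- move=> k j c d s; apply: sval_inj; apply: funext => x.
  congr (sval c _); apply: funext => i.
  congr (sval (d i) _); apply: funext => l.
  by rewrite -[in RHS](permKV (s i) l) -block_sumE permK.
Qed.

Definition prod_inj_operad : set_operad gT := SetOperad prod_inj_axioms.

Variable pt : U.

Definition based_inj (n : nat) (f : prod_inj_operad n) : Prop :=
  sval (f : prod_inj n) (fun=> pt) = pt.

Lemma based_inj_closed : (forall g, g # pt = pt) -> operad_closed based_inj.
Proof.
move=> ptE; split; rewrite /based_inj //=.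
- move=> n g f fE; rewrite -[RHS](ptE g) -[in RHS]fE; congr (_ # sval f _).
  by apply: funext => i.
- move=> k j c d cE dE; rewrite -[RHS]cE; congr (sval c _).
  by apply: funext => i.
Qed.

End Injections.

Definition V_operad (gT : finGroupType) (U : gset gT) : cat_operad gT :=
  chaotic_operad (sum_inj_operad U).

Definition Vbar_times_operad (gT : finGroupType) (U : gset gT) : cat_operad gT :=
  chaotic_operad (prod_inj_operad U).

Definition V_times_operad (gT : finGroupType) (U : gset gT) (pt : U)
    (ptE : forall g, gset_act g pt = pt) : cat_operad gT :=
  chaotic_operad (sub_set_operad (based_inj_closed ptE)).

(* Main.v *)
(** The realization of a chaotic category contracts onto any object v by the
    cone homotopy ([x_0, ..., x_n; t], s) |-> [v, x_0, ..., x_n; s, (1 - s) t],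
    which commutes with every functor fixing v; so the fixed points of a subgroup
    are contractible as soon as the subgroup fixes an object.  Conversely, sending
    a point [x; t] to the vertex x_i with i the least index such that t_i <> 0 is
    a well defined (discontinuous) natural map to the set of objects, so a fixed
    point of the realization yields a fixed object.

    A subgroup L meeting
    Sigma_j trivially is a graph over a subgroup of G, and a fixed injection is an
    injective L-map X -> U from a countable L-set X.  It is built orbit by orbit,
    an orbit with stabilizer H going to a copy of G/H of its own in U; in the based
    case one composes with the transposition of two fixed points of U. *)

Require Import Defs.
From mathcomp Require Import all_boot all_order all_algebra all_fingroup.
From mathcomp Require Import all_classical all_reals all_analysis.
From mathcomp Require Import generic_quotient.
From Stdlib Require Import Relation_Operators.
Set Implicit Arguments.
Unset Strict Implicit.
Unset Printing Implicit Defensive.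
Import Order.TTheory GRing.Theory Num.Theory.
Import numFieldNormedType.Exports.
Local Open Scope classical_set_scope.
Local Open Scope quotient_scope.

(** * Cones on maps out of finite ordinals *)

(** One construction serves three purposes: coning the vertices of a simplex, its barycentric
    coordinates, and the simplicial operators. *)
Definition cone_fun (A : Type) n (v : A) (f : 'I_n -> A) (i : 'I_n.+1) : A :=
  if unlift ord0 i is Some k then f k else v.

Lemma cone_fun0 A n (v : A) (f : 'I_n -> A) : cone_fun v f ord0 = v.
Proof. by rewrite /cone_fun unlift_none. Qed.

Lemma cone_funS A n (v : A) (f : 'I_n -> A) k : cone_fun v f (lift ord0 k) = f k.
Proof. by rewrite /cone_fun liftK. Qed.

Lemma ord_liftP n (P : 'I_n.+1 -> Prop) :
  P ord0 -> (forall k, P (lift ord0 k)) -> forall i, P i.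
Proof. by move=> P0 PS i; case: (unliftP ord0 i) => [k|] ->. Qed.

Lemma ordinal_functor_homo m n
    (theta : functor (ordinal_category m) (ordinal_category n)) (i j : 'I_m.+1) :
  (i <= j)%N -> (theta i <= theta j)%N.
Proof. exact: (@Defs.fmap _ _ theta i j). Qed.

Definition ordinal_functor m n (f : 'I_m.+1 -> 'I_n.+1)
    (fP : forall i j : 'I_m.+1, (i <= j)%N -> (f i <= f j)%N) :
    functor (ordinal_category m) (ordinal_category n) :=
  @Functor (ordinal_category m) (ordinal_category n) f fP
    (fun=> bool_irrelevance _ _) (fun _ _ _ _ _ => bool_irrelevance _ _).

Lemma cone_fun_homo m n (f : 'I_m.+1 -> 'I_n.+1) :
  (forall i j : 'I_m.+1, (i <= j)%N -> (f i <= f j)%N) ->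
  forall i j : 'I_m.+2, (i <= j)%N ->
  (cone_fun ord0 (fun k => lift ord0 (f k)) i <=
   cone_fun ord0 (fun k => lift ord0 (f k)) j)%N.
Proof.
move=> fP; elim/ord_liftP => [|k]; first by move=> j; rewrite cone_fun0.
elim/ord_liftP => [|l] //; rewrite !cone_funS /= /bump /= !add1n !ltnS.
exact: fP.
Qed.

(** The join of [theta] with a new initial vertex; coning a simplex is natural along it. *)
Definition cone_operator m n
    (theta : functor (ordinal_category m) (ordinal_category n)) :
    functor (ordinal_category m.+1) (ordinal_category n.+1) :=
  ordinal_functor (cone_fun_homo (@ordinal_functor_homo m n theta)).

Lemma lift0_homo n (i j : 'I_n.+1) :
  (i <= j)%N -> ((lift ord0 i : 'I_n.+2) <= (lift ord0 j : 'I_n.+2))%N.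
Proof. by rewrite /= /bump /= !add1n ltnS. Qed.

Lemma ord0_homo n (i j : 'I_1) :
  (i <= j)%N -> ((ord0 : 'I_n.+1) <= (ord0 : 'I_n.+1))%N.
Proof. by []. Qed.

(** * The cone homotopy on the realization of a chaotic category *)

Section Cone.
Variables (R : realType) (T : Type) (v : T).
Local Notation C := (chaotic T).
Local Notation simp n := (set_type (@simplex R n)).
Local Notation space := (classifying_space R C).

(* Clamping the parameter keeps the cone inside the simplex for every real s, so
   that the homotopy is continuous on the whole product with R. *)
Definition clamp (s : R) : R := Num.min 1%R (Num.max 0%R s).

Lemma clamp_id s : (0 <= s <= 1)%R -> clamp s = s.
Proof. by move=> /andP[s0 s1]; rewrite /clamp (max_idPr s0) (min_idPr s1). Qed.

Lemma clamp_ge0 s : (0 <= clamp s)%R.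
Proof. by rewrite /clamp le_min ler01 le_max lexx. Qed.

Lemma clamp_le1 s : (0 <= 1 - clamp s)%R.
Proof. by rewrite subr_ge0 /clamp ge_min lexx. Qed.

Lemma clamp_continuous : continuous clamp.
Proof.
move=> s; apply: (@continuous_min R R (fun=> 1%R) (Num.max 0%R)); first exact: cvg_cst.
by apply: (@continuous_max R R (fun=> 0%R) id) => //; exact: cvg_cst.
Qed.

Definition cone_row n (t : 'rV[R]_n) (s : R) : 'rV[R]_n.+1 :=
  (\row_i cone_fun (clamp s) (fun k => (1 - clamp s) * t ord0 k) i)%R.

Lemma cone_row_simplex n (t : 'rV[R]_n.+1) s :
  simplex t -> simplex (cone_row t s).
Proof.
move=> [t0 t1]; split.
  elim/ord_liftP => [|k]; rewrite mxE ?cone_fun0 ?cone_funS ?clamp_ge0//.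
  by rewrite mulr_ge0 ?clamp_le1.
rewrite big_ord_recl mxE cone_fun0.
rewrite (eq_bigr (fun k => (1 - clamp s) * t ord0 k)%R); last first.
  by move=> k _; rewrite mxE cone_funS.
by rewrite -mulr_sumr t1 mulr1 addrC subrK.
Qed.

Definition cone_pt n (t : simp n) (s : R) : simp n.+1 :=
  exist _ (cone_row (set_val t) s)
    (mem_set (cone_row_simplex s (set_mem (valP t)))).

Definition cone_nerve n (x : nerve C n) : nerve C n.+1 :=
  @chaotic_functor (ordinal_category n.+1) T (cone_fun v x).

Definition cone_cell (a : cells R C) (s : R) : cells R C :=
  let: existT n (x, t) := a in cell (cone_nerve x) (cone_pt t s).

(** Only 0 lies over 0 under [cone_operator theta], so coordinate 0 is the cone parameter on both
    sides; over the later vertices the fibres are those of [theta], shifted by one. *)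
Lemma cone_row_push m n (theta : functor (ordinal_category m) (ordinal_category n))
    (t : 'rV[R]_m.+1) s :
  cone_row (simplex_push theta t) s =
  simplex_push (cone_operator theta) (cone_row t s).
Proof.
apply/rowP => i; rewrite !mxE big_mkcond big_ord_recl /= cone_fun0 mxE cone_fun0.
under eq_bigr => k _ do rewrite cone_funS mxE cone_funS.
elim/ord_liftP: i => [|i]; rewrite ?cone_fun0 ?cone_funS ?eqxx.
  by rewrite big1 ?addr0.
rewrite /= add0r mxE mulr_sumr [LHS]big_mkcond.
by apply: eq_bigr.
Qed.

Lemma cone_cell_glue (a b : cells R C) s :
  glue_eq a b -> glue_eq (cone_cell a s) (cone_cell b s).
Proof.
move=> /asboolP H; apply/asboolP.
elim: {a b} H => [a b [m n theta x t t' tE]|a|a b _ IH|a b c _ IH1 _ IH2].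
- rewrite /=; apply: rst_step.
  (* An elementary gluing along [theta] becomes an elementary gluing along its cone operator. *)
  have -> : cone_nerve (functor_comp x theta) =
            functor_comp (cone_nerve x) (cone_operator theta).
    apply: functor_chaotic_eq; elim/ord_liftP => [|k] /=.
      by rewrite !cone_fun0.
    by rewrite !cone_funS.
  apply: Glue; rewrite -[RHS]/(simplex_push _ (cone_row (set_val t) s)).
  by rewrite -cone_row_push -tE.
- exact: rst_refl.
- exact: rst_sym.
- exact: rst_trans IH1 IH2.
Qed.

Definition cone_homotopy (z : space) (s : R) : space :=
  \pi_space (cone_cell (repr z) s).

Lemma cone_homotopy_pi a s :
  cone_homotopy (\pi_space a) s = \pi_space (cone_cell a s).
Proof.
apply/eqmodP; apply: cone_cell_glue.
by have /eqmodP := reprK (\pi_space a).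
Qed.

(** At parameter 0 the new vertex has weight 0, so the point lies on the face opposite to it, which
    is the original simplex. *)
Lemma cone_homotopy0 z : cone_homotopy z 0%R = z.
Proof.
rewrite -[RHS]reprK /cone_homotopy; apply/eqmodP.
case: (repr z) => n [x t]; apply/asboolP; apply: rst_sym; apply: rst_step.
have xE : functor_comp (cone_nerve x) (ordinal_functor (@lift0_homo n)) = x.
  by apply: functor_chaotic_eq => k /=; rewrite cone_funS.
have c0 : clamp 0%R = 0%R by rewrite clamp_id// lexx ler01.
have tE : set_val (cone_pt t 0%R) =
    simplex_push (ordinal_functor (@lift0_homo n)) (set_val t).
  apply/rowP; elim/ord_liftP => [|k]; rewrite !mxE ?cone_fun0 ?cone_funS c0.
    by rewrite big1// => l /eqP.
  by rewrite (big_pred1 k) ?subr0 ?mul1r.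
by have := Glue (cone_nerve x) tE; rewrite xE.
Qed.

Lemma simplex0 : simplex (const_mx 1%R : 'rV[R]_1).
Proof. by split=> [i|]; rewrite ?big_ord1 mxE ?ler01. Qed.

Definition simplex_pt : simp 0 := exist _ (const_mx 1%R) (mem_set simplex0).

Definition vertex : space :=
  \pi_space (cell (@chaotic_functor (ordinal_category 0) T (fun=> v))
    simplex_pt).

(** At parameter 1 all weight sits on the new vertex, so the point comes from the 0-simplex [v]
    along the inclusion of vertex 0. *)
Lemma cone_homotopy1 z : cone_homotopy z 1%R = vertex.
Proof.
rewrite /cone_homotopy; apply/eqmodP.
case: (repr z) => n [x t]; apply/asboolP; apply: rst_sym; apply: rst_step.
have xE : functor_comp (cone_nerve x) (ordinal_functor (@ord0_homo n.+1)) =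
    @chaotic_functor (ordinal_category 0) T (fun=> v).
  by apply: functor_chaotic_eq => k /=; rewrite cone_fun0.
have c1 : clamp 1%R = 1%R by rewrite clamp_id// lexx ler01.
have tE : set_val (cone_pt t 1%R) = simplex_push (ordinal_functor (@ord0_homo n.+1))
    (set_val simplex_pt).
  apply/rowP => i; rewrite !mxE big_mkcond big_ord1 mxE.
  by elim/ord_liftP: i => [|k]; rewrite ?cone_fun0 ?cone_funS c1 ?eqxx// subrr mul0r.
by have := Glue (cone_nerve x) tE; rewrite xE.
Qed.

Lemma cone_homotopy_map (F : functor C C) z s :
  F v = v -> cone_homotopy (space_map F z) s = space_map F (cone_homotopy z s).
Proof.
move=> Fv; rewrite -[z in LHS]reprK space_map_pi cone_homotopy_pi.
rewrite /cone_homotopy space_map_pi; congr (\pi _).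
case: (repr z) => n [x t] /=; congr (cell _ _).
apply: functor_chaotic_eq; elim/ord_liftP => [|k] /=; first by rewrite !cone_fun0.
by rewrite !cone_funS.
Qed.

Lemma vertex_map (F : functor C C) : F v = v -> space_map F vertex = vertex.
Proof.
move=> Fv; rewrite space_map_pi; congr (\pi _).
by congr cell; exact: functor_chaotic_eq.
Qed.

Lemma cone_row_continuous n :
  continuous (fun ts : 'rV[R]_n * R => cone_row ts.1 ts.2).
Proof.
have cs : continuous (fun ts : 'rV[R]_n * R => clamp ts.2).
  move=> ts; apply: (@continuous_comp _ _ _ snd clamp); first exact: cvg_snd.
  exact: clamp_continuous.
have ct k : continuous (fun ts : 'rV[R]_n * R => ts.1 ord0 k).
  move=> ts; apply: (@continuous_comp _ _ _ fst (fun u : 'rV[R]_n => u ord0 k)).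
    exact: cvg_fst.
  exact: coord_continuous.
have cont_ij i j : continuous (fun ts : 'rV[R]_n * R => cone_row ts.1 ts.2 i j).
  elim/ord_liftP: j => [|k].
    rewrite (_ : (fun _ => _) = (fun ts : 'rV[R]_n * R => clamp ts.2)) //.
    by apply: funext => ts; rewrite mxE cone_fun0.
  rewrite (_ : (fun _ => _) =
    (fun ts : 'rV[R]_n * R => (1 - clamp ts.2) * ts.1 ord0 k)%R).
    by move=> ts; apply: cvgM; [apply: cvgB; [exact: cvg_cst|exact: cs]|exact: ct].
  by apply: funext => ts; rewrite mxE cone_funS.
(* Matrix neighbourhoods are given entry by entry; finitely many entries can be controlled at
   once. *)
move=> ts A [P tP PA].
have FF : Filter (nbhs ts) := @nbhs_filter ('rV[R]_n * R)%type ts.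
have near_j i := @filter_forall _ _ (fun j ts => P i j (cone_row ts.1 ts.2 i j))
  (nbhs ts) FF (fun j => cont_ij i j ts _ (tP i j)).
have := @filter_forall _ _ (fun i ts => forall j, P i j (cone_row ts.1 ts.2 i j))
  (nbhs ts) FF near_j.
by apply: filterS => us H; exact: PA.
Qed.

Lemma cone_pt_continuous n : continuous (fun ts : simp n * R => cone_pt ts.1 ts.2).
Proof.
apply: continuous_comp_initial => ts.
apply: (@continuous_comp _ _ _ (fun ts : simp n * R => (set_val ts.1, ts.2))
  (fun ts : 'rV[R]_n.+1 * R => cone_row ts.1 ts.2)); last exact: cone_row_continuous.
apply: (@cvg_pair _ _ _ _ (nbhs (set_val ts.1)) (nbhs ts.2)); last exact: cvg_snd.
apply: (@continuous_comp _ _ _ (@fst (simp n) R) set_val); first exact: cvg_fst.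
exact: initial_continuous.
Qed.

Lemma cone_cell_continuous :
  continuous (fun c : cells R C * R => cone_cell c.1 c.2).
Proof.
move=> [[n p] s] A A_nbhs.
pose D n : topologicalType :=
  (discrete_topology {classic nerve C n} * simp n)%type.
have c1 : continuous (fun q : D n * R => q.1.1).
  by move=> q; apply: (@continuous_comp _ _ _ (@fst (D n) R) fst); exact: cvg_fst.
have c2 : continuous (fun q : D n * R => (q.1.2, q.2)).
  move=> q; apply: (@cvg_pair _ _ _ _ (nbhs q.1.2) (nbhs q.2)); last exact: cvg_snd.
  by apply: (@continuous_comp _ _ _ (@fst (D n) R) snd);
    [exact: cvg_fst|exact: cvg_snd].
pose f (q : D n * R) : D n.+1 :=
  (cone_nerve (q.1.1 : nerve C n), cone_pt q.1.2 q.2).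
have fA : \forall q \near (p, s), A (existT _ n.+1 (f q)).
  have : existT _ n.+1 \o f @ (p, s) --> cone_cell (existT _ n p) s.
    rewrite [cone_cell _ _](_ : _ = existT _ n.+1 (f (p, s))); last by case: (p).
    apply: continuous_comp; last exact: existT_continuous.
    apply: (@cvg_pair _ _ _ _ (nbhs (f (p, s)).1) (nbhs (f (p, s)).2)).
    - move=> B /nbhs_singleton Bp.
      (* The nerve is discrete, so the simplex is locally constant and only its coordinates vary. *)
      have pE := c1 (p, s) _ (discrete_set1 p.1).
      suff : \forall q \near (p, s), B (f q).1 by [].
      apply: (@filterS _ _ (@nbhs_filter (D n * R)%type (p, s)) _ _ _ pE) => q qE.
      by rewrite /f /= qE.
    - exact: (@continuous_comp _ _ _ _ (fun ts : simp n * R => cone_pt ts.1 ts.2)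
        _ (c2 (p, s)) (@cone_pt_continuous n _)).
  by move=> /(_ A A_nbhs).
case: fA => -[P Q] /= [Pp Qs] PQA.
(* Each summand of the disjoint union is open, so [P] stays a neighbourhood there. *)
exists (existT _ n @` P, Q); first by split=> //; exact: existT_nbhs.
move=> [a u] [/= [[x t] Pxt <-] Qu].
exact: (PQA ((x, t), u)).
Qed.

(* The product of a quotient map with R need not obviously be a quotient map:
   one descends to the quotient after currying, and uncurries since R is locally
   compact. *)
Lemma cone_homotopy_continuous :
  continuous (fun zs : space * R => cone_homotopy zs.1 zs.2).
Proof.
have cont : continuous (fun c : cells R C * R => \pi_space (cone_cell c.1 c.2)).
  move=> c; apply: (@continuous_comp _ _ _ (fun c => cone_cell c.1 c.2)).
    exact: cone_cell_continuous.
  exact: pi_continuous.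
have [curry_cont curry_contr] := continuous_curry cont.
rewrite (_ : (fun _ => _) = uncurry cone_homotopy); last first.
  by apply: funext => -[].
apply: continuous_uncurry_regular.
- exact: locally_compactR.
- exact: uniform_regular.
- apply: (proj2 (@quotient_continuous _ _ {compact-open, R -> space} cone_homotopy)).
  rewrite [_ \o _](_ : _ = curry (fun c => \pi_space (cone_cell c.1 c.2))) //.
  by apply: funext => a; apply: funext => s; exact: cone_homotopy_pi.
- by move=> z; exact: (curry_contr (repr z)).
Qed.

End Cone.

(** * The leading vertex, an invariant of points of the realization *)

Section LeadingObject.
Variables (R : realType) (T : Type).
Local Notation C := (chaotic T).

(** Kept as a relation: gluing preserves the object but not the index [i]. *)
Definition leading_object (c : cells R C) (a : T) : Prop :=
  let: existT n (x, t) := c in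
  exists i : 'I_n.+1, [/\ (x : nerve C n) i = a, set_val t ord0 i != 0%R &
    forall k : 'I_n.+1, (k < i)%N -> set_val t ord0 k = 0%R].

Lemma leading_object_ex c : exists a, leading_object c a.
Proof.
case: c => n [x t]; have [t0 t1] := set_mem (valP t).
have [i ti] : exists i, set_val t ord0 i != 0%R.
  apply/not_existsP => H; have /eqP := t1; rewrite big1 => [|i _].
    by rewrite eq_sym oner_eq0.
  by apply/eqP/negPn/negP; exact: H.
case: (arg_minnP (P := fun i => set_val t ord0 i != 0%R) (fun i => nat_of_ord i) ti).
move=> j tj jmin; exists ((x : nerve C n) j), j; split=> // k kj.
by apply/eqP/negPn/negP => /jmin; rewrite leqNgt kj.
Qed.

Lemma leading_object_uniq c a b :
  leading_object c a -> leading_object c b -> a = b.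
Proof.
case: c => n [x t] [i [<- ti imin]] [j [<- tj jmin]].
case: (ltngtP i j) => [/jmin E|/imin E|/val_inj -> //].
  by rewrite E eqxx in ti.
by rewrite E eqxx in tj.
Qed.

(** The new leading index is [theta i]: its coordinate is a sum of nonnegative terms containing a
    positive one, and by monotonicity any smaller index collects only coordinates before [i], all
    zero. *)
Lemma leading_object_glue c d a :
  Defs.glue c d -> leading_object c a -> leading_object d a.
Proof.
case=> m n theta x t t' tE [i [xi ti imin]]; exists (theta i).
have t_ge0 k : (0 <= set_val t ord0 k)%R by have [] := set_mem (valP t).
split=> //; first rewrite tE mxE.
  rewrite psumr_neq0 => [|k _]; last exact: t_ge0.
  by apply/hasP; exists i; rewrite ?mem_index_enum// eqxx lt0r ti t_ge0.
move=> k ki; rewrite tE mxE; apply: big1 => l /eqP lk.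
apply: imin; rewrite ltnNge; apply/negP => /(@ordinal_functor_homo _ _ theta).
by rewrite lk leqNgt ki.
Qed.

Lemma leading_object_glue_eq c d a b :
  glue_eq c d -> leading_object c a -> leading_object d b -> a = b.
Proof.
move=> /asboolP H; elim: {c d} H a b => [c d g|c|c d _ IH|c d e _ IH1 _ IH2] a b.
- by move=> /(leading_object_glue g); exact: leading_object_uniq.
- exact: leading_object_uniq.
- by move=> ca db; rewrite (IH b a).
- move=> ca eb; have [u du] := leading_object_ex d.
  by rewrite (IH1 a u) // (IH2 u b).
Qed.

Lemma leading_object_map (F : functor C C) c a :
  leading_object c a -> leading_object (cell_map F c) (F a).
Proof. by case: c => n [x t] [i [<- ti imin]]; exists i; split. Qed.

(** The object depends on [z] alone, so a single one is fixed by every functor fixing [z], hence by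
    a whole subgroup at once. *)
Lemma fixed_object_of_fixed_point (z : classifying_space R C) :
  exists a, forall F : functor C C, space_map F z = z -> F a = a.
Proof.
have [a za] := leading_object_ex (repr z); exists a => F Fz.
apply: (@leading_object_glue_eq (cell_map F (repr z)) (repr z)) => //.
  by apply/eqmodP; rewrite -/(space_map F z) Fz reprK.
exact: leading_object_map.
Qed.

End LeadingObject.

(** * Fixed points of group actions on chaotic categories *)

Section ChaoticAction.
Variables (R : realType) (K : finGroupType) (T : Type).
Variable act : K -> functor (chaotic T) (chaotic T).
Hypothesis act1 : act 1%g = functor_id (chaotic T).
Hypothesis actM : forall g h, act (g * h)%g = functor_comp (act g) (act h).
Local Notation E := (classifying_gspace R (GCategory act1 actM)).

Lemma chaotic_fixed_contractible (L : {set K}) (v : T) :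
  (forall l, l \in L -> act l v = v) ->
  contractible R (set_type (fixed_points E L)).
Proof.
move=> Lv.
(* Each element of [L] fixes [v], so it commutes with the cone homotopy, which therefore restricts
   to the fixed points. *)
have hP (z : set_type (fixed_points E L)) (s : R) :
    cone_homotopy v (set_val z : classifying_space R (chaotic T)) s
      \in fixed_points E L.
  apply/mem_set => l lL; rewrite /= -cone_homotopy_map ?Lv//.
  by congr cone_homotopy; exact: (set_mem (valP z) l lL).
have vP : vertex R v \in fixed_points E L.
  by apply/mem_set => l lL; exact: vertex_map (Lv l lL).
exists (exist _ (vertex R v) vP),
  (fun zs => exist _ (cone_homotopy v (set_val zs.1) zs.2) (hP zs.1 zs.2)).
split=> [|z|z].
- apply: continuous_subspaceT; apply: continuous_comp_initial => zs.
  apply: (@continuous_comp _ _ _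
    (fun zs : set_type (fixed_points E L) * R => (set_val zs.1, zs.2))
    (fun zs : classifying_space R (chaotic T) * R => cone_homotopy v zs.1 zs.2)).
    apply: (@cvg_pair _ _ _ _ (nbhs (set_val zs.1)) (nbhs zs.2)); last exact: cvg_snd.
    apply: (@continuous_comp _ _ _ (@fst (set_type (fixed_points E L)) R) set_val).
      exact: cvg_fst.
    exact: initial_continuous.
  exact: cone_homotopy_continuous.
- by apply: val_inj; exact: cone_homotopy0.
- by apply: val_inj; exact: cone_homotopy1.
Qed.

Lemma chaotic_G_contractible (v : T) :
  (forall g, act g v = v) -> G_contractible R E.
Proof.
move=> Kv.
exists (vertex R v), (fun zs => cone_homotopy v zs.1 zs.2); split.
- by apply: continuous_subspaceT; exact: cone_homotopy_continuous.
- exact: cone_homotopy0.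
- exact: cone_homotopy1.
- by move=> g; exact: vertex_map (Kv g).
- by move=> g x t _; exact: cone_homotopy_map (Kv g).
Qed.

Lemma chaotic_fixed_points_eq0 (L : {set K}) :
  (forall v : T, ~ forall l, l \in L -> act l v = v) -> fixed_points E L = set0.
Proof.
move=> noL; apply/seteqP; split=> // z zL.
have [a za] := fixed_object_of_fixed_point (z : classifying_space R (chaotic T)).
by apply: (noL a) => l lL; apply: za; exact: zL.
Qed.

End ChaoticAction.

(** * Reduction of the bundle condition to the existence of fixed objects *)

Section ChaoticOperads.
Variables (R : realType) (gT : finGroupType) (O : set_operad gT).

(** The combinatorial content of the bundle condition for a chaotic operad: all that remains to be
    checked for injections. *)
Definition fixed_iff_trivial (j : nat) : Prop :=
  forall L : {group gT * 'S_j}, sigma_trivial L <->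
    exists c : O j, forall l, l \in L -> sop_act l.1 (sop_sym c l.2) = c.

Lemma chaotic_universal_bundle j : fixed_iff_trivial j ->
  universal_principal_bundle R
    (classifying_gspace R (operad_sigma_gcategory (chaotic_operad O) j)).
Proof.
move=> fixj L; split=> [/fixj[c cL]|nL].
  apply: (@chaotic_fixed_contractible _ _ (O j)
    (gcat_act (operad_sigma_gcategory (chaotic_operad O) j)) _ _ _ c).
  exact: cL.
apply: (@chaotic_fixed_points_eq0 _ _ (O j)
  (gcat_act (operad_sigma_gcategory (chaotic_operad O) j))) => c cL.
by apply: nL; apply/fixj; exists c.
Qed.

Lemma chaotic_E_infty :
  (forall j, fixed_iff_trivial j) -> E_infty_operad R (chaotic_operad O).
Proof.
move=> fix_; split=> [|j _]; last exact: chaotic_universal_bundle.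
(* In arity 0 the symmetric group is trivial, so the whole group qualifies and provides a G-fixed
   object. *)
have tr : sigma_trivial [set: gT * 'S_0]%G.
  by move=> s _; apply/permP => -[].
have [c cP] := (fix_ 0 _).1 tr.
apply: (@chaotic_G_contractible _ _ (O 0)
  (gcat_act (operad_gcategory (chaotic_operad O) 0)) _ _ c) => g.
by have := cP (g, 1%g) (finset.in_setT _); rewrite /= (sym_1 (sop_axioms O)).
Qed.

End ChaoticOperads.

(** * Equivariant embeddings of countable sets into the universe *)

Section OrbitPoints.
Variables (gT : finGroupType) (U : gset gT).
Local Notation "g # u" := (gset_act g u) (at level 40).

Lemma gset_actK (K : finGroupType) (X : gset K) (g : K) :
  cancel (@gset_act K X g) (@gset_act K X g^-1%g).
Proof. by move=> u; rewrite -gset_actM mulVg gset_act1. Qed.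

Lemma gset_actKV (K : finGroupType) (X : gset K) (g : K) :
  cancel (@gset_act K X g^-1%g) (@gset_act K X g).
Proof. by move=> u; rewrite -gset_actM mulgV gset_act1. Qed.

Definition conj_class (H : {group gT}) : pred {group gT} :=
  fun H' => [exists g, H' :==: (H :^ g)%g].

Definition conj_repr (H : {group gT}) : {group gT} := choose (conj_class H) H.

Lemma conj_class_refl H : conj_class H H.
Proof. by apply/existsP; exists 1%g; rewrite conjsg1. Qed.

Lemma conj_reprP H : exists g, conj_repr H :=: (H :^ g)%g.
Proof.
by have /existsP[g /eqP E] := chooseP (conj_class_refl H); exists g.
Qed.

(** Conjugate subgroups have the same conjugacy class, and [choose] depends neither on the form of
    the predicate nor on the member it starts from. *)
Lemma conj_repr_conj (H H' : {group gT}) g :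
  H' :=: (H :^ g)%g -> conj_repr H' = conj_repr H.
Proof.
move=> E; rewrite /conj_repr (eq_choose (Q := conj_class H)).
  apply: choose_id; last exact: conj_class_refl.
  by apply/existsP; exists g; rewrite E.
move=> J; apply/existsP/existsP => -[h /eqP JE].
  by exists (g * h)%g; rewrite JE E conjsgM.
by exists (g^-1 * h)%g; rewrite JE E -conjsgM mulgA mulgV mul1g.
Qed.

(* Passing to one representative of each conjugacy class of subgroups makes the
   chosen orbits disjoint even for different, but conjugate, stabilizers. *)
Lemma orbit_points : (forall H : {group gT}, contains_copies U H) ->
  exists p : {group gT} -> nat -> U,
    (forall H n g, g # p H n = p H n <-> g \in H) /\
    (forall H H' n n' g, g # p H n = p H' n' -> n = n').
Proof.
move=> /choice[iota iotaP].
have [r rP] := choice conj_reprP.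
pose base H n := iota (conj_repr H) n (conj_repr H).
have coset_in (H : {group gT}) g : (g *: H)%g \in lcosets H [set: gT]%SET.
  by apply/lcosetsP; exists g; rewrite ?finset.in_setT.
have self_in (H : {group gT}) : (H : {set gT}) \in lcosets H [set: gT]%SET.
  by have := coset_in H 1%g; rewrite lcoset1 // mul1g.
have baseE H n g : g # base H n = iota (conj_repr H) n (g *: conj_repr H)%g.
  by rewrite (iotaP _).1.
(* The stabilizer of [base H n] is [H :^ r H]; translating by [r H] makes it [H]. *)
exists (fun H n => r H # base H n).
have stab H n g : g # (r H # base H n) = r H # base H n <-> g \in H.
  rewrite -(memJ_conjg H (r H) g) -rP; split=> [E|gH].
    have {}E : (g ^ r H)%g # base H n = base H n.
      by rewrite conjgE !gset_actM E gset_actK.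
    move: E; rewrite baseE => /(iotaP _).2[] // _ <-.
    exact: lcoset_refl.
  have E : (g ^ r H)%g # base H n = base H n by rewrite baseE lcoset_id.
  by rewrite -[in RHS]E -!gset_actM conjgE !mulgA mulgV mul1g.
split=> // H H' n n' g E.
(* Points of one orbit have conjugate stabilizers, hence share a representative and a family of
   copies, where disjointness applies. *)
have H'E : H' :=: (H :^ g^-1)%g.
  apply/setP => k; rewrite mem_conjgV; apply/idP/idP.
    move=> /(stab H' n'); rewrite -E => kE; apply/(stab H n).
    by rewrite conjgE 2!gset_actM kE gset_actK.
  move=> /(stab H n) kE; apply/(stab H' n'); rewrite -E -{2}kE.
  by rewrite conjgE -!gset_actM !mulgA mulgV mul1g.
have cE := conj_repr_conj H'E.
have {}E : ((r H')^-1 * g * r H)%g # base H n = base H' n'.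
  by rewrite !gset_actM E gset_actK.
move: E; rewrite baseE /base cE => /(iotaP _).2[] //.
Qed.

(** An injection [e] into the naturals does double duty: its least value on an orbit selects the
    representative, and this value numbers the copy that receives the orbit. *)
Lemma equivariant_embedding (j : nat) (L : {group gT * 'S_j})
    (X : gset (gT * 'S_j)%type) :
  (forall H : {group gT}, contains_copies U H) ->
  countable [set: X] -> sigma_trivial L ->
  exists f : X -> U, injective f /\
    forall l x, l \in L -> f (gset_act l x) = l.1 # f x.
Proof.
move=> /orbit_points[p [pstab pdisj]] /countable_injP[e /in2TT e_inj] trL.
(* [L] projects injectively to G: elements with equal first components differ by an element of
   Sigma_j. *)
have Lfst l l' : l \in L -> l' \in L -> l.1 = l'.1 -> l = l'.
  case: l l' => [g s] [g' s'] lL l'L /= E; subst g'; congr pair.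
  have : ((g, s)^-1 * (g, s'))%g \in L by rewrite groupM ?groupV.
  rewrite [X in X \in _](_ : _ = (1%g, (s^-1 * s')%g)); last first.
    by congr pair; rewrite /= mulVg.
  by move=> /trL /(congr1 (mulg s)); rewrite mulg1 mulKVg.
(* [H] is the image in G of the stabilizer of [x0] in [L]. *)
have stab_ex (x0 : X) : exists H : {group gT}, forall g, g \in H <->
    exists2 l, l \in L & gset_act l x0 = x0 /\ l.1 = g.
  pose S := finset (fun g => `[< exists2 l, l \in L & gset_act l x0 = x0 /\ l.1 = g >]).
  have SP g : g \in S <-> exists2 l, l \in L & gset_act l x0 = x0 /\ l.1 = g.
    by rewrite finset.in_set; split=> /asboolP.
  have Sg : group_set S.
    apply/group_setP; split; first by apply/SP; exists 1%g; rewrite ?group1 ?gset_act1.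
    move=> g h /SP[l lL [lx lg]] /SP[k kL [kx kh]].
    apply/SP; exists (l * k)%g; first exact: groupM.
    by rewrite gset_actM kx lx -lg -kh.
  by exists (Group Sg) => g; exact: SP.
have [H HP] := choice stab_ex.
have rep_ex (x : X) : exists yl : X * (gT * 'S_j), [/\ yl.2 \in L, x = gset_act yl.2 yl.1 &
    forall l, l \in L -> (e yl.1 <= e (gset_act l yl.1))%N].
  pose P n := `[< exists2 l, l \in L & e (gset_act l x) = n >].
  have exP : exists n, P n.
    by exists (e x); apply/asboolP; exists 1%g; rewrite ?group1 ?gset_act1.
  case: (ex_minnP exP) => n /asboolP[l lL ln] nmin.
  exists (gset_act l x, l^-1%g); split=> /= [||k kL].
  - by rewrite groupV.
  - by rewrite gset_actK.
  - rewrite ln; apply: nmin; apply/asboolP; exists (k * l)%g; first exact: groupM.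
    by rewrite gset_actM.
have [r rP] := choice rep_ex.
have rL x : (r x).2 \in L by case: (rP x).
have rx x : x = gset_act (r x).2 (r x).1 by case: (rP x).
have rmin x l : l \in L -> (e (r x).1 <= e (gset_act l (r x).1))%N.
  by case: (rP x) => _ _; exact.
(* Both representatives lie in one orbit and minimize [e] there, so they agree by injectivity of
   [e]. *)
have r_orbit x l : l \in L -> (r (gset_act l x)).1 = (r x).1.
  move=> lL; set y := gset_act l x.
  have E : gset_act ((r y).2^-1 * l * (r x).2)%g (r x).1 = (r y).1.
    by rewrite !gset_actM -rx -/y {2}(rx y) gset_actK.
  have gL : ((r y).2^-1 * l * (r x).2)%g \in L by rewrite !groupM ?groupV.
  apply/e_inj/eqP; rewrite eqn_leq -{2}E (rmin x _ gL) andbT.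
  by have := rmin y _ (groupVr gL); rewrite -{2}E gset_actK.
exists (fun x => (r x).2.1 # p (H (r x).1) (e (r x).1)); split=> [x y E|l x lL].
  have : ((r y).2.1^-1 * (r x).2.1)%g # p (H (r x).1) (e (r x).1) =
      p (H (r y).1) (e (r y).1) by rewrite gset_actM E gset_actK.
  (* The copy number determines the representative; the remaining discrepancy stabilizes its image,
     so by [Lfst] it lifts to the stabilizer of the representative. *)
  move=> {}E; have xy := e_inj _ _ (pdisj _ _ _ _ _ E).
  move: E; rewrite xy => /pstab /HP[k kL [kx kE]].
  have {}kE : k = ((r y).2^-1 * (r x).2)%g.
    by apply: (Lfst k ((r y).2^-1 * (r x).2)%g) => //; rewrite groupM ?groupV.
  by rewrite (rx x) (rx y) xy -{2}kx kE gset_actM gset_actKV.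
rewrite r_orbit // -gset_actM; set y := gset_act l x; set x0 := (r x).1.
(* The chosen carrier of [y] may differ from [l] times that of [x], but only by a stabilizer of the
   representative. *)
suff E : ((r y).2.1^-1 * (l.1 * (r x).2.1))%g # p (H x0) (e x0) = p (H x0) (e x0).
  by rewrite -[in LHS]E -gset_actM mulgA mulgV mul1g.
apply/pstab/HP; exists ((r y).2^-1 * (l * (r x).2))%g.
  by rewrite !groupM ?groupV.
split=> //; rewrite !gset_actM -rx -/y {2}(rx y) gset_actK.
exact: r_orbit.
Qed.

End OrbitPoints.

(** * Transpositions, used to move an injection onto the basepoint *)

Definition transpose (T : Type) (a b u : T) : T :=
  if `[< u = a >] then b else if `[< u = b >] then a else u.

Lemma transposeK (T : Type) (a b : T) : involutive (transpose a b).
Proof.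
move=> u; rewrite /transpose.
case: (asboolP (u = a)) => [->|ua].
  case: (asboolP (b = a)) => [->|_]; first by [].
  by case: (asboolP (b = b)).
case: (asboolP (u = b)) => [->|ub]; first by case: (asboolP (a = a)).
by case: (asboolP (u = a)) => // _; case: (asboolP (u = b)).
Qed.

Lemma transposeL (T : Type) (a b : T) : transpose a b a = b.
Proof. by rewrite /transpose; case: (asboolP (a = a)). Qed.

Lemma transpose_act (K : finGroupType) (X : gset K) (a b u : X) (g : K) :
  gset_act g a = a -> gset_act g b = b ->
  transpose a b (gset_act g u) = gset_act g (transpose a b u).
Proof.
move=> ga gb; rewrite /transpose.
have -> : `[< gset_act g u = a >] = `[< u = a >].
  by apply/asboolP/asboolP => [|->//]; rewrite -{1}ga => /gset_act_inj.
have -> : `[< gset_act g u = b >] = `[< u = b >].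
  by apply/asboolP/asboolP => [|->//]; rewrite -{1}gb => /gset_act_inj.
by case: ifP => // _; case: ifP.
Qed.

(** * Injections fixed by subgroups of the product with Sigma_j *)

Section Operads.
Variables (gT : finGroupType) (U : gset gT).
Hypothesis hU : universe_gset U.
Local Notation "g # u" := (gset_act g u) (at level 40).

Section GSets.
Variable j : nat.

(** Chosen so that the objects fixed by [L] are exactly the [L]-equivariant injections; the inverse
    is needed for a left action. For [prod_act], precomposition already gives one, the product of
    permutations being reversed composition. *)
Definition sum_act (l : gT * 'S_j) (x : 'I_j * U) : 'I_j * U :=
  (l.2^-1%g x.1, l.1 # x.2).

Lemma sum_act1 x : sum_act 1%g x = x.
Proof. by case: x => i u; rewrite /sum_act /= invg1 perm1 gset_act1. Qed.

Lemma sum_actM l k x : sum_act (l * k)%g x = sum_act l (sum_act k x).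
Proof. by rewrite /sum_act /= invMg permM gset_actM. Qed.

Definition sum_gset : gset (gT * 'S_j)%type := GSet sum_act1 sum_actM.

Definition prod_act (l : gT * 'S_j) (x : 'I_j -> U) : 'I_j -> U :=
  fun i => l.1 # x (l.2 i).

Lemma prod_act1 x : prod_act 1%g x = x.
Proof. by apply: funext => i; rewrite /prod_act /= perm1 gset_act1. Qed.

Lemma prod_actM l k x : prod_act (l * k)%g x = prod_act l (prod_act k x).
Proof. by apply: funext => i; rewrite /prod_act /= permM gset_actM. Qed.

Definition prod_gset : gset (gT * 'S_j)%type := GSet prod_act1 prod_actM.

Lemma sum_gset_countable : countable [set: sum_gset].
Proof.
have /countable_injP[e /in2TT e_inj] := hU.1.
apply/countable_injP; exists (fun x : 'I_j * U => pickle (x.1, e x.2)).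
move=> [i u] [k v] _ _ /(pcan_inj (@pickleK _)) /= [-> /e_inj ->] //.
Qed.

Lemma prod_gset_countable : countable [set: prod_gset].
Proof.
have /countable_injP[e /in2TT e_inj] := hU.1.
apply/countable_injP; exists (fun x : 'I_j -> U => pickle [ffun i => e (x i)]).
move=> x y _ _ /(pcan_inj (@pickleK _)) /ffunP E; apply: funext => i.
by have := E i; rewrite !ffunE => /e_inj.
Qed.

End GSets.

Lemma sum_fixed_iff_trivial (pt : U) j : fixed_iff_trivial (sum_inj_operad U) j.
Proof.
move=> L; split=> [trL|[c cL] s sL].
  have [f [f_inj fL]] :=
    equivariant_embedding hU.2 (@sum_gset_countable j) trL.
  exists (exist _ f f_inj) => l lL; apply: sval_inj; apply: funext => -[i u] /=.
  by rewrite -fL //= /sum_act /= permK gset_actKV.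
apply/permP => i; rewrite perm1.
(* If [(1, s)] fixes [c], then [c] agrees at [(s i, pt)] and [(i, pt)], so [s i = i]. *)
have /(congr1 (fun d : sum_inj U j => sval d (i, pt))) := cL _ sL.
by rewrite /= gset_act1 invg1 gset_act1 => /(svalP c) [].
Qed.

(** Two copies of the one-point orbit G/G suffice; two values are needed to tell coordinates of a
    tuple apart. *)
Lemma universe_distinct : exists u v : U, u <> v.
Proof.
have [iota [_ inj]] := hU.2 [set: gT]%G.
have self_in : [set: gT]%SET \in lcosets [set: gT]%G [set: gT]%SET.
  by apply/lcosetsP; exists 1%g; rewrite ?finset.in_setT // lcoset1.
by exists (iota 0 [set: gT]%SET), (iota 1 [set: gT]%SET) => /inj[].
Qed.

Lemma prod_fixed_trivial j (L : {group gT * 'S_j}) (c : prod_inj U j) :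
  (forall l, l \in L -> prod_inj_act l.1 (prod_inj_sym c l.2) = c) ->
  sigma_trivial L.
Proof.
move=> cL s sL; apply/permP => i; rewrite perm1.
have [u [v uv]] := universe_distinct.
apply/eqP/negPn/negP => si.
(* The tuple with [u] at [i] and [v] elsewhere must be invariant under [s]; if [s] moved [i],
   coordinate [s i] would give [u = v]. *)
have /(congr1 (fun d : prod_inj U j =>
  sval d (fun k => if k == i then u else v))) := cL _ sL.
rewrite /= gset_act1 => /(svalP c) /(congr1 (@^~ (s i))).
by rewrite invg1 gset_act1 permK eqxx (negPf si).
Qed.

Lemma based_fixed_ex (pt : U) (hpt : forall g, g # pt = pt) j
    (L : {group gT * 'S_j}) : sigma_trivial L ->
  exists c : prod_inj U j, sval c (fun=> pt) = pt /\
    forall l, l \in L -> prod_inj_act l.1 (prod_inj_sym c l.2) = c.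
Proof.
move=> trL; have [f [f_inj fL]] :=
  equivariant_embedding hU.2 (@prod_gset_countable j) trL.
pose b : prod_gset j := fun=> pt.
(* The constant tuple is fixed by [L], hence so is its image; exchanging it with [pt] is then
   equivariant and makes the injection based. *)
have fb l : l \in L -> l.1 # f b = f b.
  by move=> lL; rewrite -fL //; congr f; apply: funext => i; exact: hpt.
have h_inj : injective (transpose (f b) pt \o f).
  exact: inj_comp (inv_inj (transposeK _ _)) f_inj.
exists (exist _ _ h_inj); split=> [|l lL]; first exact: transposeL.
apply: sval_inj; apply: funext => x /=.
rewrite -transpose_act ?fb // -fL //; congr (transpose _ _ (f _)).
by apply: funext => i; rewrite /= /prod_act gset_actKV permK.
Qed.

Lemma prod_fixed_iff_trivial (pt : U) (hpt : forall g, g # pt = pt) j :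
  fixed_iff_trivial (prod_inj_operad U) j.
Proof.
move=> L; split=> [/(based_fixed_ex hpt)[c [_ cL]]|[c cL]]; first by exists c.
exact: prod_fixed_trivial cL.
Qed.

Lemma based_fixed_iff_trivial (pt : U) (hpt : forall g, g # pt = pt) j :
  fixed_iff_trivial (sub_set_operad (based_inj_closed hpt)) j.
Proof.
move=> L; split=> [/(based_fixed_ex hpt)[c [cb cL]]|[c cL]].
  by exists (exist _ c cb) => l lL; apply: sval_inj; exact: cL.
apply: (prod_fixed_trivial (c := sval c)) => l lL.
exact: (congr1 sval (cL l lL)).
Qed.

End Operads.

Theorem proposition7p8 (R : realType) (gT : finGroupType) (U : gset gT)
    (hU : universe_gset U) (pt : U) (hpt : forall g : gT, gset_act g pt = pt) :
  (forall j : nat,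
    [/\ universal_principal_bundle R
          (classifying_gspace R (operad_sigma_gcategory (V_operad U) j)),
        universal_principal_bundle R
          (classifying_gspace R
            (operad_sigma_gcategory (Vbar_times_operad U) j)) &
        universal_principal_bundle R
          (classifying_gspace R
            (operad_sigma_gcategory (V_times_operad hpt) j))]) /\
  [/\ E_infty_operad R (V_operad U),
      E_infty_operad R (Vbar_times_operad U) &
      E_infty_operad R (V_times_operad hpt)].
Proof.
have sumP := sum_fixed_iff_trivial hU pt.
have prodP := prod_fixed_iff_trivial hU hpt.
have basedP := based_fixed_iff_trivial hU hpt.
split=> [j|]; split; by [exact: chaotic_universal_bundle|exact: chaotic_E_infty].
Qed.
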